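(* Let $X$ be a proper metric space. Then for every $p\in[1,+\infty]$, $$\alpha_{\ell_p}(X)=\alpha_{L_p}(X).$$ In particular, if $\Gamma$ is a finitely generated group with its canonical word metric, or a compactly generated group with its canonical proper metric, then $\alpha_{\ell_p}(\Gamma)=\alpha_{L_p}(\Gamma)$.
   Context: A metric space is proper if all its closed balls are compact. $L_p$ denotes $L_p[0,1]$. For metric spaces $(X,d_X)$ and $(Y,d_Y)$, the compression exponent $\alpha_Y(X)$ of $X$ in $Y$ is the supremum of all numbers $0\le\alpha\le1$ for which there exist $f\colon X\to Y$, $\tau\in(0,\infty)$ and $A\in[1,\infty)$ such that $d_X(x,y)\ge\tau$ implies $\frac1A d_X(x,y)^\alpha\le d_Y(f(x),f(y))\le A\,d_X(x,y)$. *)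

(* Defs.v *)
(* MathComp-Analysis *)
From HB Require Import structures.
From mathcomp Require Import all_boot all_order all_algebra.
From mathcomp Require Import all_classical all_reals all_analysis.

Set Implicit Arguments.
Unset Strict Implicit.
Unset Printing Implicit Defensive.

Import Order.TTheory GRing.Theory Num.Theory.
Import numFieldNormedType.Exports.

Local Open Scope classical_set_scope.
Local Open Scope ring_scope.

(* Distances are plain functions, so that the definition also applies to a group
   with a metric that does not induce the topology of the group.  The sup of the
   empty set is 0. *)
Definition compression_exponent (R : realType) (X Y : Type)
    (dX : X -> X -> R) (dY : Y -> Y -> R) : R :=
  sup [set a : R | 0 <= a <= 1 /\
    exists (f : X -> Y) (tau A : R), [/\ 0 < tau, 1 <= A &
      forall x y, tau <= dX x y ->
        A^-1 * dX x y `^ a <= dY (f x) (f y) <= A * dX x y]].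

Definition proper_metric_space (R : realType) (X : metricType R) : Prop :=
  forall (x : X) (r : R), compact [set y | mdist x y <= r].

(* The elements of LspaceType are classes modulo a.e. equality, coerced to
   functions by choosing a representative. *)
Definition Lspace_dist d (T : measurableType d) (R : realType)
    (mu : {measure set T -> \bar R}) (p : \bar R) (p1 : (1 <= p)%E)
    (f g : LspaceType mu p1) : R :=
  fine ('N[mu]_p[EFin \o (fun x => (f x - g x : R)%R)])%E.

Definition lebesgue01 (R : realType) : {measure set (measurableTypeR R) -> \bar R} :=
  mrestr (@lebesgue_measure R) (measurable_itv `[0, 1]).

Definition ell_dist (R : realType) (p : \bar R) (p1 : (1 <= p)%E) :=
  @Lspace_dist _ nat R counting p p1.
Arguments ell_dist {R p} p1 _ _.

Definition L01_dist (R : realType) (p : \bar R) (p1 : (1 <= p)%E) :=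
  @Lspace_dist _ _ R (lebesgue01 R) p p1.
Arguments L01_dist {R p} p1 _ _.

Section word_metric.
Variables (R : realType) (G : groupType) (S : set G).
Implicit Types (g x y : G) (w : seq G).

Definition words g : set (seq G) :=
  [set w | (forall s, s \in w -> S s \/ S (s^-1)%g) /\
           (\prod_(s <- w) s = g)%g].

Definition generates : Prop := forall g, words g !=set0.

Definition word_length g : R := inf [set (size w)%:R | w in words g].

Definition word_dist x y : R := word_length (x^-1 * y)%g.

End word_metric.
Arguments word_length R {G} S g.
Arguments word_dist R {G} S x y.

HB.mixin Record isTopologicalGroup G & Topological G & Group G := {
  mulg_continuous : continuous (fun xy : G * G => (xy.1 * xy.2)%g) ;
  invg_continuous : continuous (fun x : G => (x^-1)%g) }.

#[short(type="topologicalGroupType")]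
HB.structure Definition TopologicalGroup :=
  {G of Topological G & Group G & isTopologicalGroup G}.

(* "Proper" refers to the topology of the group, which d is not required to
   induce.  The last condition determines d up to quasi-isometry.  Both the word
   metrics of compact generating sets (word_dist_canonical below) and the
   compatible proper left-invariant metrics quasi-isometric to them qualify. *)
Definition canonical_proper_metric (R : realType) (G : topologicalGroupType)
    (d : G -> G -> R) : Prop :=
  [/\ [/\ forall x y, d x y = 0 <-> x = y,
          forall x y, d x y = d y x &
          forall x y z, d x z <= d x y + d y z],
      forall g x y : G, d (g * x)%g (g * y)%g = d x y,
      forall (x : G) (r : R), compact [set y | d x y <= r] &
      exists S : set G, [/\ compact S, generates S &
        exists L C : R, [/\ 1 <= L, 0 <= C & forall x y,
          L^-1 * word_dist R S x y - C <= d x y <= L * word_dist R S x y + C]]].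

Section word_metric_theory.
Variables (R : realType) (G : groupType) (S : set G).
Hypothesis genS : generates S.
Implicit Types (g x y : G) (w : seq G).

Lemma word_lengthP g :
  exists2 w, words S g w & word_length R S g = (size w)%:R.
Proof.
have ex : exists n, `[< exists2 w, words S g w & size w = n >].
  by have [w gw] := genS g; exists (size w); apply/asboolP; exists w.
case: (ex_minnP ex) => n /asboolP[w gw <-] minw; exists w => //.
apply/eqP; rewrite eq_le; apply/andP; split.
  apply: ge_inf; last by exists w.
  by exists 0 => _ [v _ <-]; rewrite ler0n.
apply: lb_le_inf; first by exists (size w)%:R, w.
by move=> _ [v gv <-]; rewrite ler_nat; apply/minw/asboolP; exists v.
Qed.

Lemma word_length_le g w : words S g w -> word_length R S g <= (size w)%:R.
Proof.
by move=> gw; apply: ge_inf; [exists 0 => _ [v _ <-]; rewrite ler0n|exists w].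
Qed.

Lemma word_length0 g : word_length R S g = 0 <-> g = 1%g.
Proof.
split=> [g0|->].
  have [w [_ wg] e] := word_lengthP g.
  move: g0; rewrite e => /eqP; rewrite pnatr_eq0 size_eq0 => /eqP w0.
  by rewrite -wg w0 big_nil.
have [w _ ew] := word_lengthP 1%g.
apply/eqP; rewrite eq_le {2}ew ler0n andbT.
by apply: (@word_length_le _ [::]); split=> //; rewrite big_nil.
Qed.

Lemma word_lengthM x y :
  word_length R S (x * y)%g <= word_length R S x + word_length R S y.
Proof.
have [v [Sv vx] ->] := word_lengthP x; have [w [Sw wy] ->] := word_lengthP y.
rewrite -natrD -size_cat; apply: word_length_le; split.
  by move=> s; rewrite mem_cat => /orP[/Sv|/Sw].
by rewrite big_cat/= vx wy.
Qed.

Lemma word_lengthV x : word_length R S (x^-1)%g = word_length R S x.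
Proof.
have le z : word_length R S (z^-1)%g <= word_length R S z.
  have [v [Sv vz] ->] := word_lengthP z.
  rewrite -(size_rev v) -(size_map (fun s => (s^-1)%g)).
  apply: word_length_le; split.
    move=> _ /mapP[s sv ->]; rewrite invgK.
    by move: sv; rewrite mem_rev => /Sv[]; [right|left].
  by rewrite big_map prodgV revK vz.
by apply/eqP; rewrite eq_le le -{1}(invgK x) le.
Qed.

End word_metric_theory.

Lemma word_dist_canonical (R : realType) (G : topologicalGroupType)
    (S : set G) : compact S -> generates S ->
  canonical_proper_metric (word_dist R S).
Proof.
move=> cS genS; split.
- split.
  + move=> x y; split=> [/(word_length0 _ genS) xy|->].
      by apply/esym/eqP; rewrite -(can_eq (mulKg (x^-1)%g)) xy mulVg.
    by apply/(word_length0 _ genS); rewrite mulVg.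
  + by move=> x y; rewrite /word_dist -word_lengthV// invgM invgK.
  + move=> x y z; rewrite /word_dist.
    have -> : (x^-1 * z = (x^-1 * y) * (y^-1 * z))%g by rewrite -mulgA mulVKg.
    exact: word_lengthM.
- by move=> g x y; rewrite /word_dist invgM -mulgA mulKg.
- move=> x r.
  pose T := [set 1%g] `|` (S `|` (fun s : G => (s^-1)%g) @` S).
  have cT : compact T.
    apply: compactU; first exact: compact_set1.
    apply: compactU => //; apply: continuous_compact => //.
    by apply: continuous_subspaceT; exact: invg_continuous.
  pose mul (xy : G * G) := (xy.1 * xy.2)%g.
  have cmul A B : compact A -> compact B -> compact (mul @` (A `*` B)).
    move=> cA cB; apply: continuous_compact; last exact: compact_setX.
    by apply: continuous_subspaceT; exact: mulg_continuous.
  pose W n := iter n (fun B => mul @` (T `*` B)) [set 1%g].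
  have cW n : compact (W n).
    by elim: n => [|n ih]; [exact: compact_set1|exact: cmul].
  have WP n g : W n g <-> exists2 w, words S g w & (size w <= n)%N.
    elim: n g => [|n ih] g; split.
    + by move=> ->; exists [::] => //; split=> //; rewrite big_nil.
    + by case=> -[|//] [_ <-] _; rewrite big_nil.
    + case=> -[s h] /= [Ts /ih[w [Sw wh] wn]] <-.
      case: Ts => [->|Ts].
        by exists w; [split=> //; rewrite /mul/= mul1g|exact: leqW].
      exists (s :: w) => //; split; last by rewrite big_cons wh.
      move=> t; rewrite inE => /predU1P[->|/Sw//].
      by case: Ts => [|[u Su <-]]; [left|right; rewrite invgK].
    + case=> -[[_ <-] _|s w].
        rewrite big_nil; exists (1, 1)%g; last by rewrite /mul/= mul1g.
        split; [by left|apply/ih; exists [::] => //].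
        by split=> //; rewrite big_nil.
      case=> Sw; rewrite big_cons => wg wn.
      exists (s, (\prod_(t <- w) t)%g) => //; split=> /=.
        right; have [|Ss] := Sw s (mem_head _ _); first by left.
        by right; exists (s^-1)%g; rewrite ?invgK.
      apply/ih; exists w => //; split=> // t tw.
      by apply: Sw; rewrite inE tw orbT.
  have [r0|r0] := ltP r 0.
    rewrite (_ : mkset _ = set0); first exact: compact0.
    rewrite -subset0 => y /= /le_lt_trans/(_ r0).
    have [w _] := word_lengthP R genS (x^-1 * y)%g.
    by rewrite -/(word_dist R S x y) => ->; rewrite ltrn0.
  suff -> : [set y | word_dist R S x y <= r] =
      mul @` ([set x] `*` W (Num.truncn r)).
    by apply: cmul; first exact: compact_set1.
  apply/seteqP; split=> [y /= xyr|_ [[_ h] [/= -> /WP[w wh wn]] <-]] /=.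
    exists (x, x^-1 * y)%g; last by rewrite /mul/= mulVKg.
    split=> //; apply/WP; have [w wh e] := word_lengthP R genS (x^-1 * y)%g.
    by exists w => //; rewrite truncn_ge_nat// -e.
  rewrite /word_dist mulKg; apply: (le_trans (word_length_le R wh)).
  by rewrite -truncn_ge_nat.
- exists S; split=> //; exists 1, 0; split=> // x y.
  by rewrite invr1 !mul1r subr0 addr0 lexx.
Qed.

(* Main.v *)
Require Import Defs.
From HB Require Import structures.
From mathcomp Require Import all_boot all_order all_algebra.
From mathcomp Require Import all_classical all_reals all_analysis.
From mathcomp Require Import finmap measurable_realfun ess_sup_inf lra.

Set Implicit Arguments.
Unset Strict Implicit.
Unset Printing Implicit Defensive.

Import Order.TTheory GRing.Theory Num.Theory.
Import numFieldNormedType.Exports.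

Local Open Scope classical_set_scope.
Local Open Scope ring_scope.

(** The inequality alpha_ell_p <= alpha_L_p holds because ell_p embeds
isometrically in L_p: choose a measurable map Phi from [0, 1] to nat all of
whose level sets have positive measure, and send a sequence h to h (Phi t)
divided by the p-th root of the measure of the level set of t, or by 1 if p is
infinite ([Lnorm_partition], [ell_embedding]).

For the converse, let f : X -> L_p satisfy the compression inequalities with
exponent a.  A maximal separated subset Y of X meets every ball in a finite set,
and some map from X to Y moves points by a bounded distance, so it suffices to
embed Y, where all distances between distinct points may be assumed to be at least 1.

The space L_p[0, 1] carries a probability measure, so rounding a function
pointwise to a multiple of eps moves it by at most eps in every L_p norm.  Since
distances in Y are at least 1, rounding all the f y with the same small eps only
changes the constants ([locally_finite_compression]).  The rounded functions
G y, for y in a finite subset of Y, take countably many values jointly, hence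
are all constant on the level sets of one measurable map to nat: they embed
isometrically, together with their linear combinations, in ell_p ([discretize]).

It remains to glue the embeddings of the balls of Y ([gluing]).  Let
r(x) = 1 + d(o, x), and let tent_n be a bump function which lives at the scale
r ~ 2^n and is 3/2^n-Lipschitz.  Send x to the sequence with blocks
r(x), tent_0(r(x)) G x, tent_1(r(x)) G x, ..., the n-th G x being read in
ell_p through the embedding of the n-th ball.  At most three tents are nonzero at
each point, and a difference of two products costs |tent_n(r(x)) - tent_n(r(y))|
times the norm of G x, at most a constant times |r(x) - r(y)| <= d(x, y); hence
the upper bound.  For the lower bound, either |r(x) - r(y)| >= c d(x, y)^a, and
the first block suffices; or |r(x) - r(y)| is so small that, in a block where
tent_n(r(x)) >= 1/2, the error above does not spoil the lower bound on the norm
of G x - G y.  No loss on the exponent occurs, so the suprema are taken over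
the same sets of exponents.

What is needed of X is only that every ball is covered by finitely many balls of
one fixed radius ([coarsely_proper]).  For a canonical metric on a locally
compact group, this follows from the Baire category theorem: some ball has an
interior point, and finitely many translates of it cover any given compact
ball. *)

(** * Seminorms of real functions and elements of Lebesgue spaces *)

Section Lnorm_theory.
Context d (T : measurableType d) (R : realType).
Variables (mu : {measure set T -> \bar R}) (p : \bar R).
Hypothesis p1 : (1 <= p)%E.
Implicit Types f g : T -> R.

(** The L_p seminorm as a real number; it is 0 on functions of infinite norm. *)
Definition Lnormr f : R := fine ('N[mu]_p[EFin \o f])%E.

Lemma measurable_powR_norm f (r : R) : measurable_fun [set: T] f ->
  measurable_fun [set: T] (fun x => (`|f x| `^ r)%:E).
Proof.
move=> mf; apply/measurable_EFinP.
apply: (@measurableT_comp _ _ _ _ _ _ (fun x : R => x `^ r)) => //.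
exact: measurableT_comp.
Qed.

Lemma ae_eq_Lnorm f g : measurable_fun [set: T] f -> measurable_fun [set: T] g ->
  f = g %[ae mu] -> ('N[mu]_p[EFin \o f] = 'N[mu]_p[EFin \o g])%E.
Proof.
move=> mf mg fg; rewrite unlock /Lnorm; case: p p1 => [r r1| _ |//].
  congr (_ `^ _)%E; apply: ge0_ae_eq_integral => //=.
  - exact: measurable_powR_norm.
  - exact: measurable_powR_norm.
  - by move: fg; apply: filterS => x /= fgx xT; rewrite (fgx xT).
case: ifPn => // _; apply: eq_ess_sup.
by move: fg; apply: filterS => x /= ->.
Qed.

Lemma le_Lnorm f g : measurable_fun [set: T] f -> measurable_fun [set: T] g ->
  (forall x, `|f x| <= `|g x|) ->
  ('N[mu]_p[EFin \o f] <= 'N[mu]_p[EFin \o g])%E.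
Proof.
move=> mf mg fg; rewrite unlock /Lnorm; case: p p1 => [r r1| _ |//].
  have r0 : 0 <= r by move: r1; rewrite lee_fin => /(le_trans ler01).
  rewrite gt0_ler_poweR ?invr_ge0//.
  - by rewrite in_itv/= leey integral_ge0// => x _; rewrite lee_fin powR_ge0.
  - by rewrite in_itv/= leey integral_ge0// => x _; rewrite lee_fin powR_ge0.
  apply: ge0_le_integral => //=.
  - exact: measurable_powR_norm.
  - exact: measurable_powR_norm.
  - by move=> x _; rewrite lee_fin ge0_ler_powR// nnegrE.
case: ifPn => // _; apply: le_ess_sup.
by apply: nearW => x /=; rewrite lee_fin.
Qed.

Lemma Lnormr_ge0 f : 0 <= Lnormr f.
Proof. exact/fine_ge0/Lnorm_ge0. Qed.

Lemma mem_LfunP f : f \in Lfun mu p <->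
  measurable_fun [set: T] f /\ ('N[mu]_p[EFin \o f] < +oo)%E.
Proof.
split=> [/andP[/set_mem mf /set_mem ff]//|[mf ff]].
by apply/andP; split; exact/mem_set.
Qed.

Lemma LnormrE f : f \in Lfun mu p -> (Lnormr f)%:E = ('N[mu]_p[EFin \o f])%E.
Proof.
by move=> /mem_LfunP[_ ff]; rewrite /Lnormr fineK// ge0_fin_numE ?Lnorm_ge0.
Qed.

Lemma LfunD f g : f \in Lfun mu p -> g \in Lfun mu p ->
  (fun x => f x + g x) \in Lfun mu p.
Proof.
move=> /mem_LfunP[mf ff] /mem_LfunP[mg fg]; apply/mem_LfunP; split.
  exact: measurable_funD.
by rewrite (le_lt_trans (eminkowski _ mf mg p1))// lte_add_pinfty.
Qed.

Lemma LfunZ (c : R) f : f \in Lfun mu p -> (fun x => c * f x) \in Lfun mu p.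
Proof.
move=> fL; have /mem_LfunP[mf ff] := fL; apply/mem_LfunP; split.
  exact: measurable_funM.
have := LnormZ (Lfun_Sub p1 fL) c => ->.
by rewrite lte_mul_pinfty// lee_fin.
Qed.

Lemma LfunB f g : f \in Lfun mu p -> g \in Lfun mu p ->
  (fun x => f x - g x) \in Lfun mu p.
Proof.
move=> fL /(LfunZ (-1)) gL.
by under eq_fun do rewrite -mulN1r; apply: LfunD.
Qed.

Lemma Lfun_le f g : measurable_fun [set: T] f -> g \in Lfun mu p ->
  (forall x, `|f x| <= `|g x|) -> f \in Lfun mu p.
Proof.
move=> mf /mem_LfunP[mg fg] h; apply/mem_LfunP; split=> //.
exact: (le_lt_trans (le_Lnorm mf mg h)).
Qed.

Lemma LnormrD f g : f \in Lfun mu p -> g \in Lfun mu p ->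
  Lnormr (fun x => f x + g x) <= Lnormr f + Lnormr g.
Proof.
move=> fL gL; rewrite -lee_fin EFinD !LnormrE//; last exact: LfunD.
by move: fL gL => /mem_LfunP[mf _] /mem_LfunP[mg _]; exact: eminkowski.
Qed.

Lemma LnormrZ (c : R) f : f \in Lfun mu p ->
  Lnormr (fun x => c * f x) = `|c| * Lnormr f.
Proof.
move=> fL; apply: EFin_inj; rewrite EFinM !LnormrE//; last exact: LfunZ.
exact: (LnormZ (Lfun_Sub p1 fL) c).
Qed.

Lemma Lnormr_mulBl (c c' : R) f g : f \in Lfun mu p -> g \in Lfun mu p ->
  Lnormr (fun x => c * f x - c' * g x) <=
  `|c| * Lnormr (fun x => f x - g x) + `|c - c'| * Lnormr g.
Proof.
move=> fL gL; have fgL := LfunB fL gL; rewrite -!LnormrZ//.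
rewrite (_ : (fun x => _ - _) =
    (fun x => c * (f x - g x) + (c - c') * g x)); last first.
  by apply/funext => x; lra.
by apply: LnormrD; exact: LfunZ.
Qed.

Lemma Lnormr_mulBr (c c' : R) f g : f \in Lfun mu p -> g \in Lfun mu p ->
  Lnormr (fun x => c * f x - c' * g x) <=
  `|c'| * Lnormr (fun x => f x - g x) + `|c - c'| * Lnormr f.
Proof.
move=> fL gL; have fgL := LfunB fL gL; rewrite -!LnormrZ//.
rewrite (_ : (fun x => _ - _) =
    (fun x => c' * (f x - g x) + (c - c') * f x)); last first.
  by apply/funext => x; lra.
by apply: LnormrD; exact: LfunZ.
Qed.

Lemma Lnormr_mulB_ge (c c' : R) f g : f \in Lfun mu p -> g \in Lfun mu p ->
  `|c| * Lnormr (fun x => f x - g x) <=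
  Lnormr (fun x => c * f x - c' * g x) + `|c - c'| * Lnormr g.
Proof.
move=> fL gL; have fgL := LfunB fL gL; rewrite distrC -!LnormrZ//.
rewrite (_ : (fun x => c * (_ - _)) =
    (fun x => (c * f x - c' * g x) + (c' - c) * g x)); last first.
  by apply/funext => x; lra.
by apply: LnormrD; [apply: LfunB|]; exact: LfunZ.
Qed.

Lemma Lnormr_le f g : measurable_fun [set: T] f -> g \in Lfun mu p ->
  (forall x, `|f x| <= `|g x|) -> Lnormr f <= Lnormr g.
Proof.
move=> mf gL h; have fL := Lfun_le mf gL h.
rewrite -lee_fin !LnormrE//; apply: le_Lnorm => //.
by move: gL => /mem_LfunP[].
Qed.

Lemma Lnormr0 : Lnormr (fun=> 0) = 0.
Proof. by rewrite /Lnormr Lnorm0// gt_eqF// (lt_le_trans _ p1). Qed.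

Lemma Lfun0 : (fun=> 0) \in Lfun mu p.
Proof.
apply/mem_LfunP; split; first exact: measurable_cst.
by rewrite Lnorm0// gt_eqF// (lt_le_trans _ p1).
Qed.

Lemma measurable_aeEqMfun (q : {mfun_ mu, T >-> measurableTypeR R}) :
  measurable_fun [set: T] (q : T -> R).
Proof. exact: (measurable_funPT (repr q)). Qed.

Lemma Lspace_Lfun (f : LspaceType mu p1) : (f : T -> R) \in Lfun mu p.
Proof.
apply/mem_LfunP; split; first exact: measurable_aeEqMfun.
exact: (@Lebesgue_finite _ _ _ _ _ _ f).
Qed.

(** Elements of Lebesgue spaces come with chosen representatives, so that a given
function is only recovered almost everywhere. *)
Lemma Lspace_of f : f \in Lfun mu p ->
  exists g : LspaceType mu p1, (g : T -> R) = f %[ae mu].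
Proof.
move=> fL; have /mem_LfunP[mf ff] := fL.
pose h := HB.pack_for {mfun T >-> measurableTypeR R} f
  (isMeasurableFun.Build d _ T (measurableTypeR R) f mf).
pose q : {mfun_ mu, T >-> measurableTypeR R} := \pi%qT h.
have qf : (q : T -> R) = f %[ae mu].
  by have /eqmodP/asboolP := reprK q.
have fin : finite_norm mu p q.
  rewrite /finite_norm (@ae_eq_Lnorm _ f)//; exact: measurable_aeEqMfun.
by exists (HB.pack_for (LspaceType mu p1) q
  (isFinLebesgue.Build d T R mu p p1 q fin)).
Qed.

Lemma Lspace_of_family (I : Type) (g : I -> T -> R) :
  (forall i, g i \in Lfun mu p) ->
  exists u : I -> LspaceType mu p1, forall i, (u i : T -> R) = g i %[ae mu].
Proof.
move=> gL; exists (fun i => sval (cid (Lspace_of (gL i)))) => i.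
exact: svalP (cid (Lspace_of (gL i))).
Qed.

Lemma Lspace_distE (u v : LspaceType mu p1) f g :
  measurable_fun [set: T] f -> measurable_fun [set: T] g ->
  (u : T -> R) = f %[ae mu] -> (v : T -> R) = g %[ae mu] ->
  Lspace_dist u v = Lnormr (fun x => f x - g x).
Proof.
move=> mf mg uf vg; rewrite /Lspace_dist/Lnormr; congr fine.
apply: ae_eq_Lnorm.
- by apply: measurable_funB; exact: measurable_aeEqMfun.
- by apply: measurable_funB.
by move: uf vg; apply: filterS2 => x /= uf vg xT; rewrite uf// vg.
Qed.

End Lnorm_theory.

(** * Functions that factor through a countable partition *)

Lemma ae_counting (R : realType) (P : nat -> Prop) :
  (\forall k \ae (@counting nat R), P k) <-> forall k, P k.
Proof.
split=> [[N [_ N0 PN]] k|]; last exact: nearW.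
apply: contrapT => /(PN k) Nk; move: N0; rewrite /counting.
case: ifPn => // /asboolP finN [] /eqP.
rewrite pnatr_eq0 cardfs_eq0 => /eqP/(congr1 (fun X : {fset nat} => k \in X)).
by rewrite in_fset_set// inE mem_set.
Qed.

Section countable_partition.
Context d (T : measurableType d) (R : realType).
Variables (mu : {measure set T -> \bar R}) (Phi : T -> nat).
Hypothesis mPhi : forall k, measurable (Phi @^-1` [set k]).

Lemma ae_preimage (P : nat -> Prop) :
  (\forall t \ae mu, P (Phi t)) <->
  forall k, mu (Phi @^-1` [set k]) != 0%E -> P k.
Proof.
split=> [[N [mN N0 PN]] k|h].
  apply: contra_neqP => Pk; apply: (subset_measure0 _ mN) => // t tk.
  by apply: PN => /=; rewrite (tk : Phi t = k).
suff : \forall t \ae mu, forall k, Phi t = k -> P k.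
  by apply: filterS => t /(_ _ erefl).
apply: ae_foralln => k.
have [m0|/h Pk] := eqVneq (mu (Phi @^-1` [set k])) 0%E; last exact: nearW.
exists (Phi @^-1` [set k]); split=> // t /= /not_implyP[]//.
Qed.

Lemma exists_preimage_neq0 : (0 < mu [set: T])%E ->
  exists k, mu (Phi @^-1` [set k]) != 0%E.
Proof.
move=> muT; apply: contrapT => /forallNP h.
have /ae_preimage : forall k, mu (Phi @^-1` [set k]) != 0%E -> False.
  by move=> k /h.
case=> N [mN N0 TN]; move: muT; rewrite (subset_measure0 _ mN) ?ltxx//.
by move=> t _; exact: TN.
Qed.

(** The factor [m^(1/p)] by which a sequence must be multiplied on an atom of mass
[m]: as [fine +oo = 0] and [x `^ 0 = 1], it is 1 for [p = +oo] and [m] nonzero.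
Atoms of mass 0 get weight 0, also for [p = +oo]. *)
Definition atom_weight (p m : \bar R) : R :=
  if m == 0%E then 0 else fine m `^ (fine p)^-1.

(** A function that is constant on the level sets of [Phi] has the same norm as
the sequence of its weighted values. *)
Lemma Lnorm_partition (p : \bar R) (g : nat -> R) : (1 <= p)%E ->
  (0 < mu [set: T])%E -> (forall k, mu (Phi @^-1` [set k]) < +oo)%E ->
  ('N[mu]_p[EFin \o (fun t => g (Phi t))] =
   'N[counting]_p[EFin \o
      (fun k => g k * atom_weight p (mu (Phi @^-1` [set k])))%R])%E.
Proof.
move=> p1 muT mufin.
have cT : (0 < @counting nat R [set: nat])%E.
  by rewrite /counting asboolF ?ltry//; exact: infinite_nat.
case: p p1 => [r|_|//].
  rewrite lee_fin => r1; have r0 : 0 < r by rewrite (lt_le_trans _ r1).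
  rewrite Lnorm_counting// unlock; congr (_ `^ _)%E.
  have mg : measurable_fun [set: T] (fun t => (`|g (Phi t)| `^ r)%:E).
    move=> _ Y mY; rewrite setTI.
    rewrite (_ : _ @^-1` _ = \bigcup_(k in [set k | Y (`|g k| `^ r)%:E])
      Phi @^-1` [set k]); first exact: bigcup_measurable.
    apply/seteqP; split=> [t /= Yt|t [k /= Yk tk]]; first by exists (Phi t).
    by rewrite /= tk.
  have TE : [set: T] = \bigcup_k Phi @^-1` [set k].
    by apply/seteqP; split=> // t _; exists (Phi t).
  have tr : trivIset [set: nat] (fun k => Phi @^-1` [set k]).
    by move=> i j _ _ [t [/= <- <-]].
  rewrite TE ge0_integral_bigcup//;
    [|by rewrite -TE|by move=> t _ /=; rewrite lee_fin powR_ge0].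
  apply: eq_eseriesr => k _.
  rewrite (@eq_integral _ _ _ _ _ (cst (`|g k| `^ r)%:E)); last first.
    by move=> t /set_mem /= ->.
  rewrite integral_cst// /atom_weight/=.
  have mfin : mu (Phi @^-1` [set k]) \is a fin_num by rewrite ge0_fin_numE.
  have [->|_] := eqVneq (mu _) 0%E.
    by rewrite mule0 mulr0 normr0 powR0// gt_eqF.
  rewrite -[X in (_ * X)%E](fineK mfin) normrM powRM// -EFinM.
  congr ((_ * _)%:E); rewrite ger0_norm ?powR_ge0// -powRrM mulVf ?gt_eqF//.
  by rewrite powRr1// fine_ge0.
have [k0 k0N] := exists_preimage_neq0 muT.
rewrite unlock /Lnorm muT cT.
suff h y : (ess_sup mu (abse \o (EFin \o (fun t => g (Phi t)))) <= y)%E =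
    (ess_sup counting (abse \o (EFin \o (fun k => g k *
      atom_weight +oo%E (mu (Phi @^-1` [set k])))%R)) <= y)%E.
  by apply/eqP; rewrite eq_le h lexx -h lexx.
have aw k : mu (Phi @^-1` [set k]) != 0%E ->
    atom_weight +oo%E (mu (Phi @^-1` [set k])) = 1.
  by rewrite /atom_weight => /negbTE ->; rewrite /= invr0 powRr0.
apply/(sameP ess_supP)/(iffP ess_supP) => /=.
  move=> /ae_counting H.
  by apply/(ae_preimage (fun k => (`|g k|%:E <= y)%E)) => k /aw wk;
    have := H k; rewrite wk mulr1.
move=> /(ae_preimage (fun k => (`|g k|%:E <= y)%E)) H.
apply/ae_counting => k.
have [m0|/[dup]/aw ->] := eqVneq (mu (Phi @^-1` [set k])) 0%E.
  rewrite /atom_weight m0 eqxx mulr0 normr0.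
  by apply: le_trans (H _ k0N); rewrite lee_fin.
by rewrite mulr1 => /H.
Qed.

End countable_partition.

(** * Sequences arranged in blocks *)

Section sequences.
Context (R : realType) (p : \bar R) (p1 : (1 <= p)%E).
Implicit Types (h : nat -> R) (V : nat -> nat -> R).
Local Notation N h := ('N[counting]_p[EFin \o h])%E.
Local Notation ell := (Lfun (@counting nat R) p).
Local Notation nm := (Lnormr (@counting nat R) p).

Lemma Lnorm_counting_reindex (j : nat -> nat) h : injective j ->
  (forall m, ~ range j m -> h m = 0) -> (N h = N (h \o j))%E.
Proof.
move=> jinj h0; case: p p1 => [r|_|//].
  rewrite lee_fin => r1; have r0 : 0 < r by rewrite (lt_le_trans _ r1).
  rewrite !Lnorm_counting//; congr (_ `^ _)%E.
  rewrite !nneseries_esumT//; try by move=> n; rewrite poweR_ge0.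
  rewrite -(esum_image _ j (fun m => `|(EFin \o h) m| `^ r)%E)//; last first.
    by move=> x y _ _; exact: jinj.
  rewrite [RHS]esum_mkcond; apply: eq_esum => m _.
  case: ifPn => // /negP mj; rewrite /= h0 ?normr0 ?powR0 ?gt_eqF//.
  by move=> jm; apply: mj; exact: mem_set.
rewrite unlock /Lnorm; case: ifPn => // _.
have cT : (0 < @counting nat R [set: nat])%E.
  by rewrite /counting asboolF ?ltry//; exact: infinite_nat.
suff H y : (ess_sup counting (abse \o (EFin \o h)) <= y)%E =
    (ess_sup counting (abse \o (EFin \o (h \o j))) <= y)%E.
  by apply/eqP; rewrite eq_le H lexx -H lexx.
apply/(sameP ess_supP)/(iffP ess_supP) => /ae_counting /= H; apply/ae_counting.
  move=> m; have [[k _ <-]|/h0 ->] := pselect (range j m); first exact: H.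
  by rewrite normr0 (le_trans _ (H 0%N))// lee_fin.
by move=> k; exact: H.
Qed.

Lemma le_Lnorm_counting_comp (j : nat -> nat) h : injective j ->
  (N (h \o j) <= N h)%E.
Proof.
move=> jinj.
pose h' m := if m \in range j then h m else 0.
rewrite (_ : h \o j = h' \o j); last first.
  by apply/funext => k; rewrite /h'/= mem_set//; exists k.
rewrite -(@Lnorm_counting_reindex j h')//; last first.
  by move=> m jm; rewrite /h' memNset.
by apply: le_Lnorm => // m; rewrite /h'; case: ifP => //; rewrite normr0.
Qed.

Variables (b : nat * nat -> nat) (b' : nat -> nat * nat).
Hypotheses (bK : cancel b b') (b'K : cancel b' b).

(** The sequence whose [n]-th block is [V n], where positions in blocks are
numbered through a bijection [b] between [nat * nat] and [nat]. *)
Definition glue V : nat -> R := fun m => V (b' m).1 (b' m).2.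

Let block_inj n : injective (fun k => b (n, k)).
Proof. by move=> k l /(can_inj bK)[]. Qed.

Let glue_block V n : glue V \o (fun k => b (n, k)) = V n.
Proof. by apply/funext => k; rewrite /glue/= bK. Qed.

Lemma block_le V n : glue V \in ell -> nm (V n) <= nm (glue V).
Proof.
move=> gL; have /mem_LfunP[_ gfin] := gL.
have H : (N (V n) <= N (glue V))%E.
  by rewrite -(glue_block V n); exact: le_Lnorm_counting_comp.
rewrite -lee_fin !LnormrE//; apply/mem_LfunP; split=> //.
exact: le_lt_trans H gfin.
Qed.

(** The triangle inequality for a sequence with finitely many nonzero blocks. *)
Lemma glue_Lfun_le V K : (forall n k, (K <= n)%N -> V n k = 0) ->
  (forall n, V n \in ell) ->
  glue V \in ell /\ nm (glue V) <= \sum_(n < K) nm (V n).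
Proof.
elim: K V => [|K IH] V V0 VL.
  rewrite (_ : glue V = fun=> 0); last by apply/funext => m; rewrite /glue V0.
  by rewrite Lnormr0// big_ord0; split=> //; exact: Lfun0.
(* split off the last nonzero block *)
pose V' n := if n == K then fun=> 0 else V n.
pose V'' n := if n == K then V K else fun=> 0.
have gV : glue V = fun m => glue V' m + glue V'' m.
  apply/funext => m; rewrite /glue /V' /V''; case: eqP => [->|_].
    by rewrite add0r.
  by rewrite addr0.
have [] := IH V'.
- move=> n k Kn; rewrite /V'; case: eqP => // /eqP nK; apply: V0.
  by rewrite ltn_neqAle eq_sym nK.
- by move=> n; rewrite /V'; case: eqP => // _; exact: Lfun0.
move=> V'L V'le.
have NV'' : (N (glue V'') = N (V K))%E.
  rewrite (@Lnorm_counting_reindex (fun k => b (K, k)))//; last first.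
    move=> m Hm; rewrite /glue /V''; case: eqP => // bm; exfalso; apply: Hm.
    by exists (b' m).2 => //; rewrite -bm -surjective_pairing b'K.
  by rewrite glue_block /V'' eqxx.
have V''L : glue V'' \in ell.
  by apply/mem_LfunP; split=> //; rewrite NV''; have /mem_LfunP[] := VL K.
split; first by rewrite gV; exact: LfunD.
rewrite big_ord_recr/= gV (le_trans (LnormrD p1 V'L V''L))//.
rewrite lerD//; last by rewrite /Lnormr NV''.
apply: (le_trans V'le); apply: ler_sum => i _.
by rewrite /V' ltn_eqF.
Qed.

End sequences.

Lemma nat2_bij : exists (b : nat * nat -> nat) (b' : nat -> nat * nat),
  cancel b b' /\ cancel b' b.
Proof.
have /card_set_bijP[b] := card_nat2.
by rewrite setTT_bijective => -[b' bK b'K]; exists b, b'.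
Qed.

(** * Discretization and the embedding of ell_p in L_p *)

Section level_sets.
Context d (T : measurableType d).

(** Measurability of a map with countably many values, without reference to a
sigma-algebra on its codomain. *)
Definition measurable_levels (K : Type) (u : T -> K) : Prop :=
  forall k, measurable (u @^-1` [set k]).

Lemma measurable_levels_comp (K : countType) (K' : Type) (u : T -> K)
    (c : K -> K') : measurable_levels u -> measurable_levels (c \o u).
Proof.
move=> mu k.
rewrite (_ : _ @^-1` _ = \bigcup_j
    (if `[< c j = k >] then u @^-1` [set j] else set0)).
  by apply: countable_bigcupT_measurable => // j; case: ifP.
apply/seteqP; split=> [t /= ck|t [j _]].
  by exists (u t) => //; case: ifPn => // /asboolP.
by case: ifPn => // /asboolP cj /= ->.
Qed.

Lemma measurable_levels_pair (K K' : Type) (u : T -> K) (v : T -> K') :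
  measurable_levels u -> measurable_levels v ->
  measurable_levels (fun t => (u t, v t)).
Proof.
move=> mu mv [i j].
rewrite (_ : _ @^-1` _ = u @^-1` [set i] `&` v @^-1` [set j]).
  exact: measurableI.
by apply/seteqP; split=> t /= [-> ->].
Qed.

Lemma measurable_levels_floor (R : realType) (h : T -> R) :
  measurable_fun [set: T] h -> measurable_levels (fun t => Num.floor (h t)).
Proof.
move=> mh z.
rewrite (_ : _ @^-1` _ = h @^-1` `[z%:~R, (z + 1)%:~R[%classic).
  by rewrite -[X in measurable X]setTI; exact: mh.
apply/seteqP; split=> t /=; rewrite in_itv/=.
  by move=> <-; exact: floor_itv.
by rewrite -floor_eq => /eqP.
Qed.

Lemma measurable_levels_fun (K : countType) (R : realType) (u : T -> K)
    (g : K -> R) : measurable_levels u ->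
  measurable_fun [set: T] (fun t => g (u t)).
Proof.
move=> mu _ Y mY; rewrite setTI.
rewrite (_ : _ @^-1` _ = \bigcup_j
    (if `[< Y (g j) >] then u @^-1` [set j] else set0)).
  by apply: countable_bigcupT_measurable => // j; case: ifP.
apply/seteqP; split=> [t /= Yt|t [j _]].
  by exists (u t) => //; case: ifPn => // /asboolP.
by case: ifPn => // /asboolP Yj /= ->.
Qed.

(** Finitely many maps take countably many values jointly, which are encoded by
natural numbers. *)
Lemma common_factor (X : eqType) (S : X -> T -> int) (l : seq X) :
  (forall x, measurable_levels (S x)) ->
  exists Phi : T -> nat, measurable_levels Phi /\
    forall x, x \in l -> exists g : nat -> int, forall t, S x t = g (Phi t).
Proof.
move=> mS; elim: l => [|x l [Phi [mPhi PhiS]]].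
  exists (fun=> 0%N); split=> // k.
  have [->|k0] := eqVneq k 0%N; first by rewrite preimage_cst mem_set.
  by rewrite preimage_cst memNset//= => /esym/eqP; exact/negP.
exists (fun t => choice.pickle (S x t, Phi t)); split.
  apply: (@measurable_levels_comp _ _ _ (@choice.pickle (int * nat)%type)).
  exact: measurable_levels_pair.
pose dec k := odflt (0, 0%N) (@choice.unpickle (int * nat)%type k).
have decK t : dec (choice.pickle (S x t, Phi t)) = (S x t, Phi t).
  by rewrite /dec choice.pickleK.
move=> y; rewrite inE => /predU1P[->|/PhiS[g Sg]].
  by exists (fun k => (dec k).1) => t; rewrite decK.
by exists (fun k => g (dec k).2) => t; rewrite decK.
Qed.

End level_sets.

Section discretization.
Context d (T : measurableType d) (R : realType).
Variables (mu : {measure set T -> \bar R}) (p : \bar R).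
Hypotheses (p1 : (1 <= p)%E) (mu_gt0 : (0 < mu [set: T])%E)
  (mu_fin : (mu [set: T] < +oo)%E).

Let level_fin (Phi : T -> nat) : measurable_levels Phi ->
  forall k, (mu (Phi @^-1` [set k]) < +oo)%E.
Proof.
move=> mPhi k; apply: le_lt_trans mu_fin; apply: le_measure => //.
- exact/mem_set/mPhi.
- exact/mem_set/measurableT.
Qed.

(** Finitely many integer-valued functions are sent to sequences in a way that
preserves the norms of the differences [c S_x - c' S_y].  Functions outside the
list are allowed when their coefficient vanishes. *)
Lemma discretize (X : eqType) (S : X -> T -> int) (l : seq X) :
  (forall x, measurable_levels (S x)) ->
  exists H : X -> nat -> R, forall x y (c c' : R),
    x \in l \/ c = 0 -> y \in l \/ c' = 0 ->
    ('N[counting]_p[EFin \o (fun k => c * H x k - c' * H y k)%R] =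
     'N[mu]_p[EFin \o (fun t => c * (S x t)%:~R - c' * (S y t)%:~R)%R])%E.
Proof.
move=> mS; have [Phi [mPhi PhiS]] := common_factor l mS.
have /choice[g gS] : forall x, exists g : nat -> int,
    x \in l -> forall t, S x t = g (Phi t).
  move=> x; have [/PhiS[g Sg]|] := boolP (x \in l); first by exists g.
  by exists (fun=> 0).
exists (fun x k => (g x k)%:~R * atom_weight p (mu (Phi @^-1` [set k]))).
move=> x y c c' xl yl.
have gE z e t : z \in l \/ e = 0 -> e * (S z t)%:~R = e * (g z (Phi t))%:~R :> R.
  by case=> [zl|->]; [rewrite gS|rewrite !mul0r].
pose G k : R := c * (g x k)%:~R - c' * (g y k)%:~R.
rewrite [RHS](@eq_Lnorm _ _ _ mu p _ (EFin \o (fun t => G (Phi t)))).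
  rewrite (Lnorm_partition mPhi _ p1 mu_gt0 (level_fin mPhi)).
  by apply: eq_Lnorm => k /=; rewrite /G mulrBl !mulrA.
by move=> t /=; rewrite !gE.
Qed.

Lemma ell_embedding (Phi : T -> nat) : measurable_levels Phi ->
  (forall k, 0 < mu (Phi @^-1` [set k]))%E ->
  exists J : (nat -> R) -> T -> R, [/\
    forall h, measurable_fun [set: T] (J h),
    forall h h' t, J h t - J h' t = J (fun k => h k - h' k) t &
    forall h, ('N[mu]_p[EFin \o J h] = 'N[counting]_p[EFin \o h])%E].
Proof.
move=> mPhi Phi_gt0.
pose w k := atom_weight p (mu (Phi @^-1` [set k])).
have w0 k : w k != 0.
  rewrite /w /atom_weight gt_eqF// gt_eqF// powR_gt0// fine_gt0//.
  by rewrite Phi_gt0 level_fin.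
exists (fun h t => h (Phi t) / w (Phi t)); split=> [h|h h' t|h].
- exact: (measurable_levels_fun (fun k => h k / w k) mPhi).
- by rewrite mulrBl.
- rewrite (Lnorm_partition mPhi (fun k => h k / w k) p1 mu_gt0 (level_fin mPhi)).
  by apply: eq_Lnorm => k /=; rewrite -/(w k) divfK.
Qed.

End discretization.

Lemma lebesgue01_setT (R : realType) : lebesgue01 R [set: R] = 1%E.
Proof.
rewrite /lebesgue01/= /mrestr setTI lebesgue_measure_itv/= lte_fin ltr01.
by rewrite -EFinB subr0.
Qed.

Lemma lebesgue01_partition (R : realType) :
  exists Phi : measurableTypeR R -> nat, measurable_levels Phi /\
    forall k, (0 < lebesgue01 R (Phi @^-1` [set k]))%E.
Proof.
(* [Phi] is constantly [k] on the interval [exp(-(k + 1)), exp(-k)[. *)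
pose Phi (t : measurableTypeR R) := absz (Num.floor (ln t) + 1).
have mPhi : measurable_levels Phi.
  apply: (@measurable_levels_comp _ _ _ _ _ (fun z => absz (z + 1))).
  by apply: measurable_levels_floor; exact: measurable_ln.
exists Phi; split=> // k.
pose I := `[expR (- k.+1%:R : R), expR (- k%:R : R)[%classic.
have Ik : I `<=` Phi @^-1` [set k] `&` `[0, 1]%classic.
  move=> t; rewrite /I/= in_itv/= => /andP[kt tk].
  have t0 : 0 < t by apply: lt_le_trans kt; exact: expR_gt0.
  split; last first.
    by rewrite in_itv/= (ltW t0)/= (le_trans (ltW tk)).
  suff E : Num.floor (ln t) = - (k.+1%:Z).
    by rewrite /= /Phi E -addn1 PoszD opprD -addrA addNr addr0 abszN.
  have e1 : (- k.+1%:Z)%:~R = - k.+1%:R :> R by rewrite mulrNz.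
  have e2 : (- k.+1%:Z + 1)%:~R = - k%:R :> R.
    by rewrite -addn1 PoszD opprD subrK mulrNz.
  apply: floor_def; rewrite e1 e2 -[X in X <= _]expRK -[X in _ < X]expRK.
  by rewrite ler_ln ?posrE ?expR_gt0// kt ltr_ln ?posrE ?expR_gt0.
have mI : measurable I by exact: measurable_itv.
apply: (@lt_le_trans _ _ (lebesgue_measure I)).
  rewrite lebesgue_measure_itv/= lte_fin ltr_expR ltrN2 ltr_nat leqnn.
  by rewrite -EFinB lte_fin subr_gt0 ltr_expR ltrN2 ltr_nat leqnn.
rewrite /lebesgue01/= /mrestr; apply: le_measure => //.
- exact/mem_set.
- by apply/mem_set/measurableI; [exact: mPhi|exact: measurable_itv].
Qed.

(** * Tent functions at dyadic scales *)

Section tent.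
Context (R : realType).
Implicit Types r : R.

(** A tent centered at [2^n], with support [[2^n / 3, 5 * 2^n / 3]]. *)
Definition tent (n : nat) r : R := Num.max 0 (2 - 3 * `|r / 2 ^+ n - 1|).

Lemma tent_ge0 n r : 0 <= tent n r.
Proof. by rewrite /tent le_max lexx. Qed.

Lemma tent_le2 n r : tent n r <= 2.
Proof. by rewrite /tent ge_max ler0n/= lerBlDr lerDl mulr_ge0. Qed.

Lemma tent_neq0 n r : tent n r != 0 -> 2 ^+ n < 3 * r /\ 3 * r < 5 * 2 ^+ n.
Proof.
have n0 : 0 < 2 ^+ n :> R by rewrite exprn_gt0.
rewrite /tent; case: (leP (2 - 3 * `|r / 2 ^+ n - 1|) 0); first by rewrite eqxx.
move=> h _; have : `|r / 2 ^+ n - 1| < 2 / 3 by lra.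
rewrite ltr_norml => /andP[h1 h2].
have e : r = (r / 2 ^+ n) * 2 ^+ n by rewrite divfK// gt_eqF.
by split; rewrite e; nra.
Qed.

Lemma tent_lip n r r' : `|tent n r - tent n r'| <= 3 * `|r - r'| / 2 ^+ n.
Proof.
have n0 : 0 < 2 ^+ n :> R by rewrite exprn_gt0.
have maxlip (u v : R) : `|Num.max 0 u - Num.max 0 v| <= `|u - v|.
  have [u0|u0] := leP u 0; have [v0|v0] := leP v 0; rewrite ?subrr ?normr0//.
  - rewrite ler_norml; have := ler_norm (v - u); rewrite distrC; lra.
  - rewrite ler_norml; have := ler_norm (u - v); lra.
apply: (le_trans (maxlip _ _)).
have -> : 2 - 3 * `|r / 2 ^+ n - 1| - (2 - 3 * `|r' / 2 ^+ n - 1|) =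
  3 * (`|r' / 2 ^+ n - 1| - `|r / 2 ^+ n - 1|) by lra.
rewrite normrM ger0_norm// -mulrA ler_pM2l//.
apply: (le_trans (ler_dist_dist _ _)).
rewrite opprB addrA subrK -mulrBl normrM distrC.
by rewrite (ger0_norm (_ : 0 <= (2 ^+ n)^-1))// invr_ge0 ltW.
Qed.

Lemma dyadic_scale r : 1 <= r -> exists k : nat, 2 ^+ k <= r < 2 ^+ k.+1.
Proof.
move=> r1; have r0 : 0 <= r by lra.
have t0 : (0 < Num.truncn r)%N by rewrite truncn_gt0.
exists (trunc_log 2 (Num.truncn r)); apply/andP; split.
  rewrite -natrX -truncn_ge_nat//; exact: trunc_logP.
by rewrite -natrX -truncn_lt_nat// trunc_log_ltn.
Qed.

Lemma tent_support k n r : 2 ^+ k <= r < 2 ^+ k.+1 -> tent n r != 0 ->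
  (k <= n < k.+3)%N.
Proof.
move=> /andP[kr rk] /tent_neq0[h1 h2].
have k0 : 0 < 2 ^+ k :> R by rewrite exprn_gt0.
have mono (i j : nat) : (2 ^+ i < 2 ^+ j :> R) -> (i < j)%N.
  by rewrite ltr_eXn2l// ltr1n.
apply/andP; split.
  by rewrite -ltnS; apply: mono; rewrite exprS; lra.
by apply: mono; move: rk; rewrite !exprS; lra.
Qed.

Lemma tent_large k r : 2 ^+ k <= r < 2 ^+ k.+1 -> 1 / 2 <= tent k.+1 r.
Proof.
move=> /andP[kr rk]; have k0 : 0 < 2 ^+ k.+1 :> R by rewrite exprn_gt0.
rewrite /tent le_max; apply/orP; right.
have h1 : 1 / 2 <= r / 2 ^+ k.+1.
  by rewrite ler_pdivlMr// exprS; lra.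
have h2 : r / 2 ^+ k.+1 < 1 by rewrite ltr_pdivrMr// mul1r.
by move: (r / _) h1 h2 => q h1 h2; rewrite ler0_norm; lra.
Qed.

(** The arithmetic of the upper bound on one block: [u] is the value of a tent at
one of the two points, [q] the variation of the tent between them, [s] the scale
[2^n], [v] the distance between the images, [w] the norm of one of the images,
and [r] the distance between the points. *)
Lemma tent_block_bound (u v w q s M r : R) :
  0 <= u -> u <= 2 -> 0 <= v -> v <= M * r -> 0 <= q -> 0 < s -> 0 < M ->
  q * s <= 3 * r -> w <= M * (2 * s) -> u * v + q * w <= 8 * (M * r).
Proof.
move=> u0 u2 v0 vr q0 s0 M0 qs ws.
have h1 : u * v <= 2 * (M * r) by rewrite ler_pM.
have h2 : q * w <= q * (M * (2 * s)) by rewrite ler_wpM2l.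
have h3 : q * (M * (2 * s)) = (2 * M) * (q * s) by lra.
have h4 : (2 * M) * (q * s) <= (2 * M) * (3 * r) by rewrite ler_pM2l// mulr_gt0.
lra.
Qed.

End tent.

(** The window [k <= n < k + 3] is the one of the tents that are nonzero at a point
of scale [2^k]. *)
Lemma sum_window (R : realType) (k K : nat) :
  \sum_(n < K) ((k <= n < k.+3)%N)%:R <= 3 :> R.
Proof.
have one j : \sum_(n < K) ((n == j :> nat))%:R = (j < K)%:R :> R.
  elim: K => [|K IH]; first by rewrite big_ord0.
  rewrite big_ord_recr/= IH ltnS (eq_sym K).
  by case: (ltngtP j K) => _ /=; rewrite ?mulr0n ?addr0 ?add0r.
have -> : 3 = 1 + 1 + 1 :> R by lra.
have H n : ((k <= n < k.+3)%N)%:R <=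
    (n == k)%:R + (n == k.+1)%:R + (n == k.+2)%:R :> R.
  case: (boolP (k <= n < k.+3)%N) => [/andP[kn nk]|_]; last by rewrite !addr_ge0.
  have : (n - k < 3)%N by rewrite ltn_subLR// addn3.
  have := subnK kn; case: (n - k)%N => [|[|[|//]]] <- _.
  - by rewrite add0n eqxx -addrA lerDl addr_ge0.
  - by rewrite add1n eqxx addrAC lerDr addr_ge0.
  - by rewrite add2n eqxx lerDr addr_ge0.
apply: le_trans; first by apply: ler_sum => n _; exact: H.
have le1 (c : bool) : c%:R <= 1 :> R by case: c.
by rewrite !big_split/= !one !lerD.
Qed.

(** * Gluing the embeddings of balls *)

Section gluing.
Context d (T : measurableType d) (R : realType).
Variables (mu : {measure set T -> \bar R}) (p : \bar R).
Hypotheses (p1 : (1 <= p)%E) (mu1 : mu [set: T] = 1%E).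
Local Notation ell := (Lfun (@counting nat R) p).
Local Notation nm := (Lnormr (@counting nat R) p).
Local Notation NM := (Lnormr mu p).

Let mu_gt0 : (0 < mu [set: T])%E. Proof. by rewrite mu1 lte01. Qed.
Let mu_fin : (mu [set: T] < +oo)%E. Proof. by rewrite mu1 ltry. Qed.

Lemma Lfun_cst1 (c : R) : (fun=> c) \in Lfun mu p /\ NM (fun=> c) = `|c|.
Proof.
have N1 : ('N[mu]_p[EFin \o (fun=> 1%R : R)] = 1)%E.
  case: p p1 => [r r1|_|//].
    by rewrite (Lnorm_cst1 mu r) mu1 poweR1r.
  rewrite unlock /Lnorm mu_gt0.
  by apply: ess_sup_ae_cst => //; apply: nearW => t /=; rewrite normr1.
have L1 : (fun=> 1 : R) \in Lfun mu p.
  by apply/mem_LfunP; split; [exact: measurable_cst|rewrite N1 ltry].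
have -> : (fun=> c) = (fun t : T => c * (fun=> 1) t).
  by apply/funext => t; rewrite mulr1.
split; first exact: LfunZ.
by rewrite LnormrZ// /Lnormr N1/= mulr1.
Qed.

(** The constant function 1 is transported to the first basis vector by the
trivial partition of the probability space. *)
Lemma ell_delta0 :
  let e (k : nat) : R := (k == 0%N)%:R in e \in ell /\ nm e = 1.
Proof.
have mPhi : measurable_levels (fun _ : T => 0%N).
  move=> k; rewrite preimage_cst; case: ifP => _; first exact: measurableT.
  exact: measurable0.
have E := @Lnorm_partition _ _ _ mu _ mPhi p (fun=> 1) p1 mu_gt0.
have w0 : ('N[counting]_p[EFin \o (fun k : nat => (k == 0%N)%:R%R : R)] =
    'N[mu]_p[EFin \o (fun=> 1%R : R)])%E.
  rewrite E.
    apply: eq_Lnorm => k /=; rewrite mul1r preimage_cst /atom_weight.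
    have [->|k0] := eqVneq k 0%N.
      by rewrite mem_set// mu1 onee_eq0/= powR1.
    by rewrite memNset/= ?measure0 ?eqxx// => /esym/eqP; exact/negP.
  move=> k; rewrite preimage_cst; case: ifP => _ //.
  by rewrite measure0 ltry.
have [/mem_LfunP[_ L1]] := Lfun_cst1 1; rewrite /Lnormr normr1 => N1.
by split; [apply/mem_LfunP; split=> //; rewrite w0|rewrite /Lnormr w0].
Qed.

Variables (Y : eqType) (dist : Y -> Y -> R).
Hypotheses (distxx : forall x, dist x x = 0)
  (dist_sym : forall x y, dist x y = dist y x)
  (dist_tri : forall x y z, dist x z <= dist x y + dist y z)
  (dist_sep : forall x y, x != y -> 1 <= dist x y)
  (dist_fin : forall x r, finite_set [set y | dist x y <= r]).

(** A locally finite space that maps to L_p, with values in the multiples of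
[eps] and in such a way that the compression inequalities hold, maps to ell_p
with the same exponent. *)
Lemma gluing (S : Y -> T -> int) (o : Y) (eps a b B : R) :
  let G x t := eps * (S x t)%:~R in
  0 <= a <= 1 -> 0 < b -> b <= B -> 1 <= B ->
  (forall x, measurable_levels (S x)) ->
  (forall x, G x \in Lfun mu p) -> (forall t, S o t = 0) ->
  (forall x y, x != y ->
    b * dist x y `^ a <= NM (fun t => G x t - G y t) <= B * dist x y) ->
  exists (f : Y -> nat -> R) (A : R), [/\ 1 <= A, forall x, f x \in ell &
    forall x y, x != y ->
      A^-1 * dist x y `^ a <= nm (fun k => f x k - f y k) <= A * dist x y].
Proof.
move=> G /andP[a0 a1] b0 bB B1 mS GL So Gd.
have B0 : 0 < B by exact: lt_le_trans bB.
have dist_ge0 x y : 0 <= dist x y.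
  by have [->|/dist_sep/(le_trans ler01)//] := eqVneq x y; rewrite distxx.
pose r x := 1 + dist o x.
have r1 x : 1 <= r x by rewrite lerDl.
have rlip x y : `|r x - r y| <= dist x y.
  have h1 := dist_tri o x y; have h2 := dist_tri o y x.
  by rewrite ler_norml /r; rewrite (dist_sym y x) in h2; lra.
have Go : G o = fun=> 0 by apply/funext => t; rewrite /G So mulr0.
have GB x : NM (G x) <= B * r x.
  have [->|xo] := eqVneq x o.
    by rewrite Go Lnormr0// mulr_ge0// ltW// (lt_le_trans ltr01).
  have /andP[_] := Gd _ _ xo; rewrite Go.
  under eq_fun do rewrite subr0.
  by move=> /le_trans; apply; rewrite ler_pM2l// /r dist_sym lerDr.
(* the [n]-th ball contains the support of the [n]-th tent *)
have /choice[l lP] : forall n : nat, exists l : seq Y,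
    forall x, r x <= 2 ^+ n.+1 -> x \in l.
  move=> n; have /finite_seqP[l lE] := dist_fin o (2 ^+ n.+1 - 1).
  exists l => x rx; have : [set y | dist o y <= 2 ^+ n.+1 - 1] x.
    by rewrite /= /r in rx *; lra.
  by rewrite lE.
have /choice[H HP] := fun n => @discretize _ T R mu p p1 mu_gt0 mu_fin _ S (l n) mS.
have bl n x : x \in l n \/ tent n (r x) * eps = 0.
  have [->|/tent_neq0[_ h]] := eqVneq (tent n (r x)) 0.
    by right; rewrite mul0r.
  left; apply: lP; rewrite exprS.
  have : 0 < 2 ^+ n :> R by rewrite exprn_gt0.
  lra.
(* block 0 records [r x]; block [n + 1] carries the [n]-th ball *)
pose V x n (k : nat) : R :=
  if n is n'.+1 then tent n' (r x) * eps * H n' x k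
  else r x * (k == 0%N)%:R.
have [e0L e0N] := ell_delta0.
have VN n x y : ('N[counting]_p[EFin \o (fun k => V x n.+1 k - V y n.+1 k)%R] =
    'N[mu]_p[EFin \o (fun t => tent n (r x) * G x t - tent n (r y) * G y t)%R])%E.
  by rewrite /V HP//; apply: eq_Lnorm => t /=; rewrite /G !mulrA.
have GGL n x y :
    (fun t => tent n (r x) * G x t - tent n (r y) * G y t) \in Lfun mu p.
  by apply: LfunB => //; exact: LfunZ.
have VL' n x y : (fun k => V x n.+1 k - V y n.+1 k) \in ell.
  by apply/mem_LfunP; split=> //; rewrite VN; have /mem_LfunP[] := GGL n x y.
have VL n x : V x n \in ell.
  case: n => [|n]; first exact: LfunZ.
  apply/mem_LfunP; split=> //.
  have -> : ('N[counting]_p[EFin \o V x n.+1] =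
     'N[mu]_p[EFin \o (fun t => tent n (r x) * G x t - 0 * G o t)%R])%E.
    transitivity ('N[counting]_p[EFin \o
        (fun k => tent n (r x) * eps * H n x k - 0 * H n o k)%R])%E.
      by apply: eq_Lnorm => k /=; rewrite mul0r subr0.
    rewrite HP//; last by right.
    by apply: eq_Lnorm => t /=; rewrite /G !mul0r !mulrA.
  suff /mem_LfunP[] :
    (fun t => tent n (r x) * G x t - 0 * G o t) \in Lfun mu p by [].
  by apply: LfunB => //; exact: LfunZ.
have /choice[K KP] : forall x, exists k : nat, 2 ^+ k <= r x < 2 ^+ k.+1.
  by move=> x; exact: dyadic_scale.
have V0 x n k : (K x + 4 <= n)%N -> V x n k = 0.
  case: n => [|n]; first by rewrite addn4.
  rewrite addn4 ltnS => Kn.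
  have [|/(tent_support (KP x))/andP[_]] := eqVneq (tent n (r x)) 0.
    by rewrite /V => ->; rewrite !mul0r.
  by rewrite ltnNge Kn.
have [bi [bi' [biK bi'K]]] := nat2_bij.
pose f x := glue bi' (V x).
(* [c] is chosen so that the error term [9 c B] of the lower bound is [b / 4] *)
pose c := b / (36 * B).
have c0 : 0 < c by rewrite divr_gt0// mulr_gt0.
have cB : c * B = b / 36 by rewrite /c invfM mulrA divfK// gt_eqF.
have c2 : c <= 1 / 2.
  by rewrite /c ler_pdivrMr ?mulr_gt0//; lra.
exists f, (48 * B + 1 + c^-1).
have ci0 : 0 < c^-1 by rewrite invr_gt0.
split; first lra.
  by move=> x; have [] := glue_Lfun_le p1 biK bi'K (V0 x) (VL ^~ x).
move=> x y xy; set D := dist x y.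
have D1 : 1 <= D by exact: dist_sep.
have D0 : 0 < D by exact: lt_le_trans D1.
pose W n k := V x n k - V y n k.
have fW : (fun k => f x k - f y k) = glue bi' W by [].
have WL n : W n \in ell by apply: LfunB.
have W0 n k : (maxn (K x) (K y) + 4 <= n)%N -> W n k = 0.
  move=> h; rewrite /W !V0 ?subr0//; apply: leq_trans h; rewrite leq_add2r.
    exact: leq_maxr.
  exact: leq_maxl.
have WN n : nm (W n.+1) =
    NM (fun t => tent n (r x) * G x t - tent n (r y) * G y t).
  by rewrite /Lnormr VN.
have WN0 : nm (W 0%N) = `|r x - r y|.
  rewrite (_ : W 0%N = fun k => (r x - r y) * (k == 0%N)%:R); last first.
    by apply/funext => k; rewrite /W/= mulrBl.
  by rewrite LnormrZ// e0N mulr1.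
have [gL gle] := glue_Lfun_le p1 biK bi'K W0 WL.
have /andP[Glo Ghi] := Gd _ _ xy.
have GBL : (fun t => G x t - G y t) \in Lfun mu p by exact: LfunB.
have split1 n : nm (W n.+1) <= tent n (r y) * NM (fun t => G x t - G y t) +
    `|tent n (r x) - tent n (r y)| * NM (G x).
  by rewrite WN -[X in X * _ + _](ger0_norm (tent_ge0 n (r y))) Lnormr_mulBr.
have split2 n : nm (W n.+1) <= tent n (r x) * NM (fun t => G x t - G y t) +
    `|tent n (r x) - tent n (r y)| * NM (G y).
  by rewrite WN -[X in X * _ + _](ger0_norm (tent_ge0 n (r x))) Lnormr_mulBl.
have lip n : `|tent n (r x) - tent n (r y)| * 2 ^+ n <= 3 * `|r x - r y|.
  by rewrite -ler_pdivlMr ?exprn_gt0//; exact: tent_lip.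
have BD0 : 0 < B * D by rewrite mulr_gt0.
have NMge0 := Lnormr_ge0 mu p (fun t => G x t - G y t).
have rxy : `|r x - r y| <= D by exact: rlip.
have DW n : nm (W n.+1) <= 8 * (B * D) *
    (((K x <= n < (K x).+3)%N)%:R + ((K y <= n < (K y).+3)%N)%:R).
  have n0 : 0 < 2 ^+ n :> R by rewrite exprn_gt0.
  have lipD : `|tent n (r x) - tent n (r y)| * 2 ^+ n <= 3 * D.
    by apply: (le_trans (lip n)); rewrite ler_pM2l.
  have [bx|bx] := eqVneq (tent n (r x)) 0; last first.
    rewrite (tent_support (KP x) bx).
    have [_ h] := tent_neq0 bx.
    have : nm (W n.+1) <= 8 * (B * D).
      apply: (le_trans (split1 n)).
      apply: (@tent_block_bound _ _ _ _ _ (2 ^+ n)) => //.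
      - exact: tent_ge0.
      - exact: tent_le2.
      - by apply: (le_trans (GB x)); rewrite ler_pM2l//; lra.
    by move=> /le_trans; apply; rewrite -[leLHS]mulr1 ler_pM2l ?mulr_gt0// lerDl.
  have [by0|by0] := eqVneq (tent n (r y)) 0; last first.
    rewrite (tent_support (KP y) by0).
    have [_ h] := tent_neq0 by0.
    have : nm (W n.+1) <= 8 * (B * D).
      apply: (le_trans (split2 n)).
      apply: (@tent_block_bound _ _ _ _ _ (2 ^+ n)) => //.
      - exact: tent_ge0.
      - exact: tent_le2.
      - by apply: (le_trans (GB y)); rewrite ler_pM2l//; lra.
    by move=> /le_trans; apply; rewrite -[leLHS]mulr1 ler_pM2l ?mulr_gt0// lerDr.
  apply: (le_trans (split1 n)); rewrite bx by0 subrr normr0 !mul0r addr0.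
  by rewrite mulr_ge0// ?addr_ge0// mulr_ge0// ltW.
rewrite fW; apply/andP; split; last first.
  (* at most three nonzero tents at each of the two points *)
  apply: (le_trans gle); rewrite addnS big_ord_recl.
  under eq_bigr => i _ do rewrite lift0.
  rewrite /= WN0.
  set M := (_ + 3)%N.
  have : \sum_(i < M) nm (W i.+1) <= 48 * (B * D).
    apply: (@le_trans _ _ (\sum_(i < M) (8 * (B * D) *
      (((K x <= i < (K x).+3)%N)%:R + ((K y <= i < (K y).+3)%N)%:R)))).
      by apply: ler_sum => i _; exact: DW.
    rewrite -big_distrr/= big_split/=.
    have h1 := sum_window R (K x) M; have h2 := sum_window R (K y) M.
    have -> : 48 * (B * D) = 8 * (B * D) * 6 by lra.
    by rewrite ler_pM2l ?mulr_gt0//; lra.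
  have h3 : 0 < c^-1 * D by rewrite mulr_gt0.
  move=> h4; rewrite !mulrDl mul1r; lra.
have Da0 : 0 < D `^ a by rewrite powR_gt0.
have DaD : D `^ a <= D.
  by rewrite -[leRHS](powRr1 (ltW D0)); apply: ler_powR.
suff low : c * D `^ a <= nm (glue bi' W).
  apply: le_trans low; rewrite ler_pM2r// -[leRHS]invrK lef_pV2 ?posrE//; last lra.
  have h3 : 0 < B * 48 by rewrite mulr_gt0.
  lra.
(* either block 0 detects the pair, or [r x] and [r y] are close *)
have [far|near] := leP (c * D `^ a) `|r x - r y|.
  by apply: (le_trans far); rewrite -WN0; exact: block_le.
pose n := (K x).+1.
apply: le_trans (block_le p1 biK n.+1 gL).
rewrite WN.
have bn := tent_large (KP x); rewrite -/n in bn.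
have n0 : 0 < 2 ^+ n :> R by rewrite exprn_gt0.
have rn : r x <= 2 ^+ n by have /andP[_ /ltW] := KP x.
have ry3 : r y <= 3 * 2 ^+ n.
  have h1 : D <= dist o x + dist o y by rewrite (dist_sym o x); exact: dist_tri.
  have h2 : c * D `^ a <= 1 / 2 * D by rewrite ler_pM// ltW.
  move: near; rewrite ltr_norml => /andP[h3 h4].
  by move: rn h3 h4; rewrite /r; move: (2 ^+ n) => v; lra.
have key := Lnormr_mulB_ge p1 (tent n (r x)) (tent n (r y)) (GL x) (GL y).
rewrite (ger0_norm (tent_ge0 n (r x))) in key.
have h1 : b * D `^ a / 2 <= tent n (r x) * NM (fun t => G x t - G y t).
  rewrite mulrC; apply: ler_pM => //; last lra.
  by rewrite mulr_ge0// ltW.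
have h2 : `|tent n (r x) - tent n (r y)| * NM (G y) <= 9 * (c * B) * D `^ a.
  apply: (@le_trans _ _ (`|tent n (r x) - tent n (r y)| * (B * (3 * 2 ^+ n)))).
    by rewrite ler_wpM2l//; apply: (le_trans (GB y)); rewrite ler_pM2l.
  have -> : `|tent n (r x) - tent n (r y)| * (B * (3 * 2 ^+ n)) =
    (3 * B) * (`|tent n (r x) - tent n (r y)| * 2 ^+ n).
    by move: (2 ^+ n) `|_| => u v; lra.
  have gen (u v : R) : 9 * (u * B) * v = (3 * B) * (3 * (u * v)) by lra.
  rewrite gen.
  rewrite ler_pM2l ?mulr_gt0//; apply: (le_trans (lip n)).
  by rewrite ler_pM2l// ltW.
rewrite cB in h2.
have h3 : c * D `^ a <= b * D `^ a / 4.
  rewrite [leRHS]mulrAC ler_pM2r// /c ler_pdivrMr ?mulr_gt0//.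
  have : b <= b * B by rewrite ler_peMr// ltW.
  lra.
have e3 : 9 * (b / 36) * D `^ a = b * D `^ a / 4 by lra.
lra.
Qed.

End gluing.

(** * Rounding the values *)

Section locally_finite.
Context d (T : measurableType d) (R : realType).
Variables (mu : {measure set T -> \bar R}) (p : \bar R).
Hypotheses (p1 : (1 <= p)%E) (mu1 : mu [set: T] = 1%E).
Local Notation ell := (Lfun (@counting nat R) p).
Local Notation nm := (Lnormr (@counting nat R) p).
Local Notation NM := (Lnormr mu p).
Variables (Y : eqType) (dist : Y -> Y -> R).
Hypotheses (distxx : forall x, dist x x = 0)
  (dist_sym : forall x y, dist x y = dist y x)
  (dist_tri : forall x y z, dist x z <= dist x y + dist y z)
  (dist_sep : forall x y, x != y -> 1 <= dist x y)
  (dist_fin : forall x r, finite_set [set y | dist x y <= r]).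

(** The values are rounded after subtraction of the value at the base point [o],
so that [o] is sent to 0 as required by [gluing]. *)
Lemma locally_finite_compression (F : Y -> T -> R) (o : Y) (a A : R) :
  0 <= a <= 1 -> 1 <= A -> (forall x, F x \in Lfun mu p) ->
  (forall x y, x != y ->
    A^-1 * dist x y `^ a <= NM (fun t => F x t - F y t) <= A * dist x y) ->
  exists (f : Y -> nat -> R) (A' : R), [/\ 1 <= A', forall x, f x \in ell &
    forall x y, x != y ->
      A'^-1 * dist x y `^ a <= nm (fun k => f x k - f y k) <= A' * dist x y].
Proof.
move=> a01 A1 FL Fd.
have A0 : 0 < A by exact: lt_le_trans A1.
(* rounding moves each difference by at most [2 * eps = (2 * A)^-1], which is half
   of the least value [A^-1] of the lower bound *)
pose eps := (4 * A)^-1.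
have eps0 : 0 < eps by rewrite invr_gt0 mulr_gt0.
have FoL x : (fun t => F x t - F o t) \in Lfun mu p by exact: LfunB.
pose S x t := Num.floor ((F x t - F o t) / eps).
pose G x t := eps * (S x t)%:~R.
pose e x t := G x t - (F x t - F o t).
have mS x : measurable_levels (S x).
  apply: (@measurable_levels_floor _ _ _ (fun t => (F x t - F o t) / eps)).
  have /mem_LfunP[mF _] := FoL x.
  by apply: measurable_funM => //; exact: measurable_cst.
have mG x : measurable_fun [set: T] (G x).
  exact: (measurable_levels_fun (fun z : int => eps * z%:~R) (mS x)).
have e_le x t : `|e x t| <= eps.
  rewrite /e /G; set q := F x t - F o t.
  have /andP[h1 h2] := floor_itv (q / eps).
  rewrite ler_norml; rewrite ler_pdivlMr// in h1; rewrite ltr_pdivrMr// in h2.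
  rewrite intrD mulrDl mul1r in h2; rewrite /S -/q mulrC.
  by apply/andP; split; [rewrite lerBrDr -lerBrDl|]; lra.
have [cL cN] := Lfun_cst1 p1 mu1 (2 * eps).
have eL x : e x \in Lfun mu p.
  apply: (Lfun_le p1 _ (cL)).
    apply: measurable_funB => //; by have /mem_LfunP[] := FoL x.
  move=> t; apply: (le_trans (e_le x t)).
  by rewrite ger0_norm ?mulr_ge0 ?ltW//; lra.
have GL x : G x \in Lfun mu p.
  rewrite (_ : G x = fun t => e x t + (F x t - F o t)); first exact: LfunD.
  by apply/funext => t; rewrite /e subrK.
have eeN x y : NM (fun t => e x t - e y t) <= 2 * eps.
  rewrite -[leRHS]ger0_norm ?mulr_ge0 ?(ltW eps0)// -cN.
  apply: Lnormr_le => //; first by have /mem_LfunP[] := LfunB p1 (eL x) (eL y).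
  move=> t; rewrite [leRHS]ger0_norm ?mulr_ge0 ?(ltW eps0)//.
  apply: (le_trans (ler_normB _ _)).
  have := e_le x t; have := e_le y t; lra.
have i0 : 0 < A^-1 by rewrite invr_gt0.
have iE : eps = A^-1 / 4 by rewrite /eps invfM mulrC.
have i1 : A^-1 <= 1 by rewrite invf_le1.
apply: (@gluing _ T R mu p p1 mu1 Y dist distxx dist_sym dist_tri dist_sep dist_fin
  S o eps a (A^-1 / 2) (A + 1)) => //.
- by rewrite divr_gt0.
- lra.
- lra.
- by move=> t; rewrite /S subrr mul0r floor0.
move=> x y xy; have /andP[lo hi] := Fd _ _ xy.
have D1 := dist_sep xy.
have Da1 : 1 <= dist x y `^ a.
  by have /andP[a0 _] := a01; rewrite -[leLHS](powRr0 (dist x y)) ler_powR.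
have FFL : (fun t => F x t - F y t) \in Lfun mu p by exact: LfunB.
have GGL : (fun t => G x t - G y t) \in Lfun mu p by exact: LfunB.
apply/andP; split.
  have h : NM (fun t => F x t - F y t) <= NM (fun t => G x t - G y t) + 2 * eps.
    rewrite (_ : (fun t => F x t - _) =
      (fun t => (G x t - G y t) + (e y t - e x t))); last first.
      by apply/funext => t; rewrite /e; lra.
    by apply: (le_trans (LnormrD p1 GGL (LfunB p1 (eL y) (eL x)))); rewrite lerD2l.
  have h2 : A^-1 <= A^-1 * dist x y `^ a by rewrite ler_peMr// ltW.
  rewrite mulrAC; rewrite iE in h; lra.
have h : NM (fun t => G x t - G y t) <= NM (fun t => F x t - F y t) + 2 * eps.
  rewrite (_ : (fun t => G x t - _) =
    (fun t => (F x t - F y t) + (e x t - e y t))); last first.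
    by apply/funext => t; rewrite /e; lra.
  by apply: (le_trans (LnormrD p1 FFL (LfunB p1 (eL x) (eL y)))); rewrite lerD2l.
rewrite mulrDl mul1r; rewrite iE in h; lra.
Qed.

End locally_finite.

(** * Separated nets and the equality of the compression exponents *)

Definition is_pseudometric (R : realType) (X : Type) (dist : X -> X -> R) :=
  [/\ forall x, dist x x = 0, forall x y, dist x y = dist y x &
      forall x y z, dist x z <= dist x y + dist y z].

(** Every ball is covered by finitely many balls of one fixed radius [rho]. *)
Definition coarsely_proper (R : realType) (X : Type) (dist : X -> X -> R) :=
  exists rho, forall x r, exists2 C : set X, finite_set C &
    forall y, dist x y <= r -> exists2 c, C c & dist c y <= rho.

Section compression.
Context (R : realType) (X : choiceType) (dist : X -> X -> R).
Hypothesis dist_metric : is_pseudometric dist.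

Lemma pseudometric_ge0 x y : 0 <= dist x y.
Proof.
have [dxx dsym dtri] := dist_metric.
by have := dtri x y x; rewrite dxx (dsym y x); lra.
Qed.

Definition separated (s : R) (N : set X) :=
  forall x y, N x -> N y -> x != y -> s <= dist x y.

Lemma maximal_separated (s : R) : 0 < s -> exists N,
  separated s N /\ forall x, exists2 y, N y & dist x y < s.
Proof.
move=> s0; have [dxx dsym dtri] := dist_metric.
have [N [sepN maxN]] : exists N, separated s N /\
    forall M, N `<` M -> ~ separated s M.
  apply: Zorn_bigcup => F sepF totF x y [A FA Ax] [B FB By].
  by have [AB|BA] := totF A B FA FB;
    [apply: (sepF B FB); [exact: AB|]|apply: (sepF A FA); [|exact: BA]].
exists N; split=> // x; apply: contrapT => /forall2NP far.
have Nx y : N y -> s <= dist x y.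
  by move=> Ny; case: (far y) => // /negP; rewrite -leNgt.
apply: (maxN (x |` N)).
  split=> [|sub]; first by move=> y; right.
  by have := Nx x (sub x (or_introl erefl)); rewrite dxx; lra.
move=> y z [->|Ny] [->|Nz]; [by rewrite eqxx|by move=> _; exact: Nx| |exact: sepN].
by move=> _; rewrite dsym; exact: Nx.
Qed.

Lemma separated_finite (s rho : R) (N : set X) (x : X) (r : R) :
  2 * rho < s -> separated s N ->
  (exists2 C : set X, finite_set C &
    forall y, dist x y <= r -> exists2 c, C c & dist c y <= rho) ->
  finite_set (N `&` [set y | dist x y <= r]).
Proof.
move=> rs sepN [C finC cov]; have [dxx dsym dtri] := dist_metric.
apply: (@sub_finite_set _ _ (\bigcup_(c in C) (N `&` [set y | dist c y <= rho]))).
  by move=> y [Ny /cov[c Cc cy]]; exists c.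
apply: bigcup_finite => // c _.
have [[y [Ny cy]]|none] := pselect (exists y, (N `&` [set y | dist c y <= rho]) y).
  apply: (@sub_finite_set _ _ [set y]) => // z [Nz cz] /=.
  apply: contrapT => /eqP zy; have := sepN _ _ Nz Ny zy.
  by have := dtri z c y; rewrite (dsym z c) /= in cy cz *; lra.
rewrite (_ : _ `&` _ = set0)//; apply/seteqP; split=> // y Hy.
by apply: none; exists y.
Qed.

Variables (p : \bar R) (p1 : (1 <= p)%E).

(** The condition on the exponent [a] in the definition of the compression
exponent, apart from [0 <= a <= 1]. *)
Definition compresses (Y : Type) (dY : Y -> Y -> R) (a : R) :=
  exists (f : X -> Y) (tau A : R), [/\ 0 < tau, 1 <= A &
    forall x y, tau <= dist x y ->
      A^-1 * dist x y `^ a <= dY (f x) (f y) <= A * dist x y].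

Lemma compresses_ell_L01 (a : R) :
  compresses (ell_dist p1) a -> compresses (L01_dist p1) a.
Proof.
case=> f [tau [A [tau0 A1 fP]]].
have [Phi [mPhi Phi0]] := lebesgue01_partition R.
have mu0 : (0 < lebesgue01 R [set: R])%E by rewrite lebesgue01_setT lte01.
have muy : (lebesgue01 R [set: R] < +oo)%E by rewrite lebesgue01_setT ltry.
have [J [mJ JB JN]] := ell_embedding p1 mu0 muy mPhi Phi0.
have JL x : J (f x) \in Lfun (lebesgue01 R) p.
  have /mem_LfunP[_ fin] := Lspace_Lfun (f x).
  by apply/mem_LfunP; rewrite JN.
have [g gP] := Lspace_of_family p1 JL.
exists g, tau, A; split=> // x y /fP.
rewrite (_ : ell_dist p1 _ _ = L01_dist p1 (g x) (g y))//.
rewrite /L01_dist (Lspace_distE (mJ (f x)) (mJ (f y)) (gP x) (gP y)).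
rewrite /ell_dist /Lspace_dist /Lnormr -JN; congr fine.
by apply: eq_Lnorm => t /=; rewrite JB.
Qed.

Lemma compresses_L01_ell (a : R) : coarsely_proper dist -> 0 <= a <= 1 ->
  compresses (L01_dist p1) a -> compresses (ell_dist p1) a.
Proof.
move=> [rho cp] a01 [f [tau [A [tau0 A1 fP]]]].
have [x0|noX] := pselect (exists x : X, True); last first.
  exists (fun x => False_rect _ (noX (ex_intro _ x I))), 1, 1.
  by split.
have [dxx dsym dtri] := dist_metric.
(* separation by [s] puts distinct points of the net at distance at least [tau]
   and 1, and at most one of them in each ball of radius [rho] *)
pose s := tau + 2 * `|rho| + 1.
have rho_le := ler_norm rho.
have rho0 := normr_ge0 rho.
have [s0 s1 stau srho] : [/\ 0 < s, 1 <= s, tau <= s & 2 * rho < s].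
  by rewrite /s; split; lra.
have [N [sepN netN]] := maximal_separated s0.
pose Y := {x : X | x \in N}.
have /choice[pi piP] : forall x, exists y : Y, dist x (val y) < s.
  move=> x; have [y /mem_set Ny xy] := netN x.
  by exists (exist _ y Ny).
case: x0 => x0 _.
pose dY (y z : Y) := dist (val y) (val z).
have valN (y : Y) : N (val y) by apply/set_mem/valP.
have dYsep y z : y != z -> s <= dY y z.
  by move=> yz; apply: sepN.
have [g [A' [A'1 gL gP]]] : exists (g : Y -> nat -> R) (A' : R), [/\ 1 <= A',
    forall y, g y \in Lfun counting p & forall y z, y != z ->
    A'^-1 * dY y z `^ a <= Lnormr counting p (fun k => g y k - g z k) <=
    A' * dY y z].
  apply: (@locally_finite_compression _ _ R (lebesgue01 R) p p1
    (lebesgue01_setT R) Y dY _ _ _ _ _ (fun y => f (val y) : R -> R) (pi x0)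
    a A) => //.
  - by move=> x; exact: dxx.
  - by move=> x y; exact: dsym.
  - by move=> x y z; exact: dtri.
  - by move=> x y /dYsep; exact: le_trans.
  - move=> x r.
    apply: (@sub_finite_set _ _
      (val @^-1` (N `&` [set y | dist (val x) y <= r]))) => [y|].
      by move=> xy; split=> //; exact: valN.
    apply: finite_preimage; last exact: separated_finite srho sepN (cp _ _).
    by move=> y z _ _; exact: val_inj.
  - by move=> y; exact: Lspace_Lfun.
  - move=> y z /dYsep/(le_trans stau)/fP; exact.
have [h hP] := Lspace_of_family p1 (fun x => gL (pi x)).
have A'0 : 0 < A' by exact: lt_le_trans A'1.
exists h, (4 * s), (2 * A'); split; [by rewrite mulr_gt0|lra|].
move=> x y xy.
have -> : ell_dist p1 (h x) (h y) =
    Lnormr counting p (fun k => g (pi x) k - g (pi y) k).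
  by apply: Lspace_distE.
have px := piP x; have py := piP y.
have t1 := dtri x (val (pi x)) y; have t2 := dtri (val (pi x)) (val (pi y)) y.
have t3 := dtri (val (pi x)) x (val (pi y)); have t4 := dtri x y (val (pi y)).
rewrite (dsym (val (pi y)) y) in t2; rewrite (dsym (val (pi x)) x) in t3.
have [lo hi] : dist x y / 2 <= dY (pi x) (pi y) /\ dY (pi x) (pi y) <= 2 * dist x y.
  by rewrite /dY; split; lra.
have pxy : pi x != pi y.
  apply/eqP => E; move: lo; rewrite E /dY dxx; lra.
have /andP[glo ghi] := gP _ _ pxy.
have D0 : 0 < dist x y by apply: lt_le_trans xy; rewrite mulr_gt0.
apply/andP; split; last first.
  by apply: (le_trans ghi); rewrite (mulrC 2) -mulrA ler_pM2l.
apply: le_trans glo; have /andP[a0 a1] := a01.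
have h1 : (dist x y / 2) `^ a <= dY (pi x) (pi y) `^ a.
  apply: ge0_ler_powR => //; rewrite nnegrE; last exact: pseudometric_ge0.
  by apply: divr_ge0 => //; exact: ltW.
have h2 : dist x y `^ a / 2 <= (dist x y / 2) `^ a.
  rewrite powRM ?(ltW D0) ?invr_ge0// ler_wpM2l ?powR_ge0//.
  by rewrite -[leLHS]powRr1 ?invr_ge0// ger_powR// invr_gt0 ltr0n invf_le1 ?ler1n.
have -> : (2 * A')^-1 * dist x y `^ a = A'^-1 * (dist x y `^ a / 2).
  by rewrite invfM; lra.
by rewrite ler_pM2l ?invr_gt0//; exact: le_trans h1.
Qed.

Lemma compression_exponent_eq : coarsely_proper dist ->
  compression_exponent dist (ell_dist p1) = compression_exponent dist (L01_dist p1).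
Proof.
move=> cp; rewrite /compression_exponent; congr sup.
apply/seteqP; split=> a [a01 h]; split=> //.
  exact: compresses_ell_L01.
exact: compresses_L01_ell.
Qed.
End compression.

(** * Coarse properness of the metrics *)

Lemma compact_finite_cover (T : topologicalType) (I : Type) (K : set T)
    (U : I -> set T) : compact K -> (forall x, K x -> exists i, nbhs x (U i)) ->
  exists2 C : set I, finite_set C & forall x, K x -> exists2 i, C i & U i x.
Proof.
move=> /compact_near_coveringP cK KU.
(* the filter of the large finite sets of indices *)
pose F := filter_from (@finite_set I)
  (fun C => [set C' | finite_set C' /\ C `<=` C']).
have FF : Filter F.
  apply: filter_from_filter; first by exists set0; exact: finite_set0.
  move=> A B fA fB; exists (A `|` B); first by rewrite /= finite_setU.
  by move=> C [fC AB]; split; split=> // x ?; apply: AB; [left|right].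
have [C fC CK] : \forall C \near F, K `<=` (fun x => exists2 i, C i & U i x).
  apply: cK => x /KU[i xi].
  exists (U i, [set C | finite_set C /\ [set i] `<=` C]) => /=.
    by split=> //; exists [set i] => //; exact: finite_set1.
  by move=> [y C] /= [Uy [_ iC]]; exists i => //; exact: iC.
by exists C => //; apply: (CK C); split.
Qed.

Lemma compact_decreasing_nonempty (T : topologicalType) (C : nat -> set T) :
  (forall n, compact (C n)) -> (forall n, closed (C n)) ->
  (forall n, C n !=set0) -> (forall n, C n.+1 `<=` C n) ->
  exists x, forall n, C n x.
Proof.
move=> compC clC neC decC.
have decC' m n : (m <= n)%N -> C n `<=` C m.
  move=> /subnK <-; elim: (n - m)%N => // k IH.
  by apply: subset_trans IH; rewrite addSn; exact: decC.
apply: contrapT => noC.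
have /compact_near_coveringP cC0 := compC 0%N.
have [N _ NC] : \forall n \near \oo, C 0%N `<=` (fun x => ~ C n x).
  apply: cC0 => x C0x.
  have [m Cmx] : exists m, ~ C m x.
    apply: contrapT => h; apply: noC; exists x => n; apply: contrapT => ?.
    by apply: h; exists n.
  exists (~` C m, [set n | (m <= n)%N]) => /=.
    split; last by exists m.
    by apply: open_nbhs_nbhs; split=> //; exact/closed_openC/clC.
  by move=> [y n] /= [Cmy mn] /(decC' _ _ mn).
have [x CNx] := neC N.
exact: (NC N (leqnn N) x (decC' 0%N N (leq0n N) x CNx)).
Qed.

(** The Baire category theorem for countable closed covers of a locally compact
Hausdorff space. *)
Lemma locally_compact_Baire (T : topologicalType) (K : nat -> set T) (x0 : T) :
  hausdorff_space T -> locally_compact [set: T] ->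
  (forall n, closed (K n)) -> (forall x, exists n, K n x) ->
  exists n, (K n)° !=set0.
Proof.
move=> hT lcT clK covK; apply: contrapT => noint.
pose good (C : set T) := [/\ compact C, closed C & C° !=set0].
(* a compact set with nonempty interior contains another one that avoids [K n] *)
have step (nC : nat * set T) : exists C' : set T, good nC.2 ->
    [/\ good C', C' `<=` nC.2 & forall x, C' x -> ~ K nC.1 x].
  case: nC => n C /=; have [[cC clC [y Cy]]|] := pselect (good C); last by exists C.
  have [z [Cz Kz]] : exists z, C° z /\ ~ K n z.
    apply: contrapT => h; apply: noint; exists n, y.
    apply: (@filterS _ (nbhs y) _ C°).
      by move=> z Cz; apply: contrapT => Kz; apply: h; exists z.
    by apply: open_nbhs_nbhs; split=> //; exact: open_interior.
  have nC : nbhs z C by exact: Cz.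
  have nK : nbhs z (~` K n).
    by apply: open_nbhs_nbhs; split=> //; exact/closed_openC/clK.
  have [V zV VCK] := compact_regular hT cC nC (filterI nC nK).
  have VC : closure V `<=` C by move=> t /VCK[].
  exists (closure V) => _; split=> //; last by move=> t /VCK[].
  split.
  - by apply: subclosed_compact cC VC; exact: closed_closure.
  - exact: closed_closure.
  - by exists z; apply: filterS zV; exact: subset_closure.
have /choice[nxt nxtP] := step.
have [C0 nC0 [cC0 clC0]] := lcT x0 I.
rewrite withinET in nC0.
pose C := fix C n := if n is m.+1 then nxt (m, C m) else C0.
have goodC n : good (C n).
  elim: n => [|n IH]; first by split=> //; exists x0.
  by have [] := nxtP (n, C n) IH.
have [x Cx] : exists x, forall n, C n x.
  apply: compact_decreasing_nonempty => n; have [] := goodC n => //.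
  - by move=> _ _ [x Cx]; exists x; exact: interior_subset Cx.
  - by move=> _ _ _; have [] := nxtP (n, C n) (goodC n).
have [n Knx] := covK x.
by have [_ _ /(_ x (Cx n.+1))] := nxtP (n, C n) (goodC n).
Qed.

Lemma proper_coarsely_proper (R : realType) (X : metricType R) :
  proper_metric_space X -> coarsely_proper (@mdist R X).
Proof.
move=> prX; exists 1 => x r.
have [C fC covC] : exists2 C : set X, finite_set C &
    forall y, mdist x y <= r -> exists2 c, C c & ball c 1 y.
  apply: (@compact_finite_cover _ _ [set y | mdist x y <= r] (fun c => ball c 1)).
    exact: prX.
  by move=> y _; exists y; exact: nbhsx_ballx.
by exists C => // y /covC[c Cc]; rewrite ballEmdist => /ltW cy; exists c.
Qed.

Lemma mdist_pseudometric (R : realType) (X : metricType R) :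
  is_pseudometric (@mdist R X).
Proof.
split; [exact: mdistxx|exact: metric_sym|exact: metric_triangle].
Qed.

Lemma word_dist_pseudometric (R : realType) (G : groupType) (S : set G) :
  generates S -> is_pseudometric (word_dist R S).
Proof.
move=> genS; split=> [x|x y|x y z].
- by apply/(word_length0 _ genS); rewrite mulVg.
- by rewrite /word_dist -word_lengthV// invgM invgK.
- rewrite /word_dist.
  have -> : (x^-1 * z = (x^-1 * y) * (y^-1 * z))%g by rewrite -mulgA mulVKg.
  exact: word_lengthM.
Qed.

Lemma word_dist_coarsely_proper (R : realType) (G : groupType) (S : set G) :
  finite_set S -> generates S -> coarsely_proper (word_dist R S).
Proof.
move=> finS genS; exists 0 => x r.
(* [W n] is the set of the products of at most [n] generators or inverses *)
pose T := [set 1%g] `|` (S `|` (fun s : G => (s^-1)%g) @` S).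
have finT : finite_set T.
  rewrite !finite_setU; split; first exact: finite_set1.
  by split=> //; exact: finite_image.
pose mul (xy : G * G) := (xy.1 * xy.2)%g.
pose W n := iter n (fun B => mul @` (T `*` B)) [set 1%g].
have finW n : finite_set (W n).
  elim: n => [|n IH]; first exact: finite_set1.
  by apply: finite_image; exact: finite_setX.
have W1 n : W n 1%g.
  elim: n => // n IH; exists (1, 1)%g; last by rewrite /mul/= mul1g.
  by split=> //; left.
have WP n w : (forall s, s \in w -> S s \/ S (s^-1)%g) -> (size w <= n)%N ->
    W n (\prod_(s <- w) s)%g.
  elim: n w => [|n IH] w Sw.
    by rewrite leqn0 size_eq0 => /eqP ->; rewrite big_nil.
  case: w Sw => [|s w] Sw wn; first by rewrite big_nil; exact: W1.
  exists (s, \prod_(t <- w) t)%g; last by rewrite big_cons.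
  split=> /=; last by apply: IH => // t tw; apply: Sw; rewrite inE tw orbT.
  right; have [|Ss] := Sw s (mem_head _ _); first by left.
  by right; exists (s^-1)%g; rewrite ?invgK.
exists ((fun g => x * g)%g @` W (Num.truncn r)); first exact: finite_image.
move=> y xyr; exists y; last by have [->] := word_dist_pseudometric R genS.
exists (x^-1 * y)%g; last by rewrite mulVKg.
have [w [Sw wg] e] := word_lengthP R genS (x^-1 * y)%g; rewrite -wg.
have wr : (size w)%:R <= r by rewrite -e.
by apply: WP => //; rewrite truncn_ge_nat// (le_trans _ wr).
Qed.

Lemma canonical_coarsely_proper (R : realType) (G : topologicalGroupType)
    (d : G -> G -> R) : hausdorff_space G -> locally_compact [set: G] ->
  canonical_proper_metric d -> coarsely_proper d.
Proof.
move=> hG lcG [[d0 dsym dtri] dinv dprop _].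
have lcont (g : G) : continuous (fun x : G => (g * x)%g).
  move=> x; apply: (@continuous_comp _ _ _ (fun x => (g, x))
    (fun xy : G * G => (xy.1 * xy.2)%g)); last exact: mulg_continuous.
  by apply: cvg_pair; [exact: cvg_cst|exact: cvg_id].
(* by the Baire theorem, some ball around 1 has an interior point [u] *)
have [n [u Ku]] : exists n, ([set y | d 1%g y <= n%:R])° !=set0.
  apply: (locally_compact_Baire 1%g hG lcG) => [n|x].
    by apply: compact_closed => //; exact: dprop.
  exists (Num.truncn (d 1%g x)).+1 => /=.
  exact/ltW/truncnS_gt.
exists n%:R => x r.
pose U g : set G := (fun y => g^-1 * y)%g @^-1` [set y | d 1%g y <= n%:R].
have [C fC covC] : exists2 C : set G, finite_set C &
    forall y, d x y <= r -> exists2 g, C g & U g y.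
  apply: (@compact_finite_cover _ _ [set y | d x y <= r] U); first exact: dprop.
  move=> y _; exists (y * u^-1)%g; apply: lcont.
  by rewrite invgM invgK -mulgA mulVg mulg1.
exists C => // y /covC[g Cg]; rewrite /U/= -(dinv g) mulg1 mulVKg.
by exists g.
Qed.

Theorem corollary13 (R : realType) (p : \bar R) (p1 : (1 <= p)%E) :
  (forall X : metricType R, proper_metric_space X ->
     compression_exponent (@mdist R X) (ell_dist p1) =
     compression_exponent (@mdist R X) (L01_dist p1)) /\
  (forall (G : groupType) (S : set G), finite_set S -> generates S ->
     compression_exponent (word_dist R S) (ell_dist p1) =
     compression_exponent (word_dist R S) (L01_dist p1)) /\
  (forall (G : topologicalGroupType) (d : G -> G -> R),
     hausdorff_space G -> locally_compact [set: G] ->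
     canonical_proper_metric d ->
     compression_exponent d (ell_dist p1) =
     compression_exponent d (L01_dist p1)).
Proof.
split=> [X prX|].
  apply: compression_exponent_eq; first exact: mdist_pseudometric.
  exact: proper_coarsely_proper.
split=> [G S finS genS|G d hG lcG cd].
  apply: compression_exponent_eq; first exact: word_dist_pseudometric.
  exact: word_dist_coarsely_proper.
apply: compression_exponent_eq; last exact: canonical_coarsely_proper.
by case: cd => -[d0 dsym dtri] _ _ _; split=> // x; exact/d0.
Qed.
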